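(* Let $n\ge 3$ and $k\ge 1$ be integers. For each of the two graphs $G=S(n;k)$ and $G=\overline{S}(n;k)$, there exists an integer partition $\lambda$ of $n(k+1)$ such that $G$ has no connected partition of type $\lambda$; consequently neither $S(n;k)$ nor $\overline{S}(n;k)$ is $e$-positive.
   Context: All graphs are finite and simple. $P_k$ denotes the path with $k$ vertices; for $k=1$ the single vertex counts as its leaf. For $n\ge 3$ and positive integers $\lambda_1,\ldots,\lambda_n$, the sun graph $S(n;\lambda_1,\ldots,\lambda_n)$ is obtained from the cycle $C_n$ with consecutive vertices $v_1,\ldots,v_n$ and $n$ disjoint paths $P_{\lambda_1},\ldots,P_{\lambda_n}$ (disjoint from the cycle) by connecting $v_i$ by an edge to a leaf of $P_{\lambda_i}$ for every $i$. The complete sun $\overline{S}(n;\lambda_1,\ldots,\lambda_n)$ is defined in the same way with $C_n$ replaced by the complete graph $K_n$ on $v_1,\ldots,v_n$. When $\lambda_1=\cdots=\lambda_n=k$ one writes $S(n;k)$ and $\overline{S}(n;k)$. A connected partition of a graph $G$ is a partition $\{V_1,\ldots,V_r\}$ of its vertex set such that every induced subgraph $G[V_i]$ is connected; its type is the integer partition whose parts are the sizes $|V_1|,\ldots,|V_r|$. The chromatic symmetric function of a graph $G$ with vertices $v_1,\ldots,v_d$ is $X_G=\sum_{\kappa} x_{\kappa(v_1)}\cdots x_{\kappa(v_d)}$, the sum over all proper colourings $\kappa:V(G)\to\mathbb{N}$, with $x_1,x_2,\ldots$ commuting variables. $G$ is $e$-positive if all coefficients of $X_G$ in the basis $\{e_\lambda\}$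 of elementary symmetric functions ($e_\lambda=e_{\lambda_1}e_{\lambda_2}\cdots$) are nonnegative. *)

(* Defs.v *)
From mathcomp Require Import all_boot all_order all_algebra.
From mathcomp Require Import finmap mpoly.

Set Implicit Arguments.
Unset Strict Implicit.
Unset Printing Implicit Defensive.

Import GRing.Theory Num.Theory.

Local Open Scope nat_scope.

Record sgraph := SGraph {
  vertex :> finType;
  adj : rel vertex;
  adj_sym : ssrbool.symmetric adj;
  adj_irr : irreflexive adj }.

Lemma induced_sym (G : sgraph) (A : {set G}) :
  ssrbool.symmetric (fun x y : {x : G | x \in A} => adj (val x) (val y)).
Proof. by move=> x y; rewrite adj_sym. Qed.

Lemma induced_irr (G : sgraph) (A : {set G}) :
  irreflexive (fun x y : {x : G | x \in A} => adj (val x) (val y)).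
Proof. by move=> x; rewrite adj_irr. Qed.

Definition induced (G : sgraph) (A : {set G}) : sgraph :=
  SGraph (@induced_sym G A) (@induced_irr G A).

Definition connected (G : sgraph) : Prop :=
  0 < #|G| /\ forall x y : G, connect (@adj G) x y.

(* The conjunct [i != j] only matters for n = 1, where it removes a loop. *)
Definition cycle_adj n : rel 'I_n := fun i j =>
  (i != j) && ((i.+1 == j %[mod n]) || (j.+1 == i %[mod n])).

Lemma cycle_adj_sym n : ssrbool.symmetric (@cycle_adj n).
Proof. by move=> i j; rewrite /cycle_adj eq_sym orbC. Qed.

Lemma cycle_adj_irr n : irreflexive (@cycle_adj n).
Proof. by move=> i; rewrite /cycle_adj eqxx. Qed.

Definition cycle_graph n : sgraph :=
  SGraph (@cycle_adj_sym n) (@cycle_adj_irr n).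

Definition complete_adj n : rel 'I_n := fun i j => i != j.

Lemma complete_adj_sym n : ssrbool.symmetric (@complete_adj n).
Proof. by move=> i j; rewrite /complete_adj eq_sym. Qed.

Lemma complete_adj_irr n : irreflexive (@complete_adj n).
Proof. by move=> i; rewrite /complete_adj eqxx. Qed.

Definition complete_graph n : sgraph :=
  SGraph (@complete_adj_sym n) (@complete_adj_irr n).

(* [inl v] is the vertex v of H; [inr (Tagged _ j)] with tag v is the j-th
   vertex, counted from 0, of the path on lam v vertices whose leaf j = 0 is
   joined to v. *)
Definition pendant_adj (H : sgraph) (lam : H -> nat) :
    rel (H + {v : H & 'I_(lam v)})%type := fun x y =>
  match x, y with
  | inl u, inl v => adj u v
  | inl u, inr q => (tag q == u) && (tagged q == 0 :> nat)
  | inr p, inl v => (tag p == v) && (tagged p == 0 :> nat)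
  | inr p, inr q => (tag p == tag q) &&
      (((tagged p).+1 == tagged q :> nat) || ((tagged q).+1 == tagged p :> nat))
  end.

Lemma pendant_adj_sym (H : sgraph) (lam : H -> nat) :
  ssrbool.symmetric (@pendant_adj H lam).
Proof.
by case=> [u|p] [v|q] //=; [exact: adj_sym | rewrite eq_sym orbC].
Qed.

Lemma pendant_adj_irr (H : sgraph) (lam : H -> nat) :
  irreflexive (@pendant_adj H lam).
Proof.
case=> [u|p] /=; first exact: adj_irr.
by rewrite eqxx orbb /= eqn_leq ltnn.
Qed.

Definition pendant_graph (H : sgraph) (lam : H -> nat) : sgraph :=
  SGraph (@pendant_adj_sym H lam) (@pendant_adj_irr H lam).

Definition sun n (lam : 'I_n -> nat) : sgraph :=
  @pendant_graph (cycle_graph n) lam.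

Definition complete_sun n (lam : 'I_n -> nat) : sgraph :=
  @pendant_graph (complete_graph n) lam.

Definition is_intpart (lam : seq nat) : bool :=
  sorted geq lam && (0 \notin lam).

Definition is_intpart_of (d : nat) (lam : seq nat) : bool :=
  is_intpart lam && (sumn lam == d).

Definition connected_partition (G : sgraph) (P : {set {set G}}) : Prop :=
  partition P [set: G] /\
  forall B : {set G}, B \in P -> connected (induced B).

Definition partition_type (G : sgraph) (P : {set {set G}}) : seq nat :=
  sort geq [seq #|B : {set G}| | B <- enum P].

Definition has_connected_partition (G : sgraph) (lam : seq nat) : Prop :=
  exists P : {set {set G}}, connected_partition P /\ partition_type P = lam.

Local Open Scope ring_scope.

(* A symmetric function in x_1, x_2, ... is given by the sequence of its
   truncations, the N-th one being obtained by setting x_i = 0 for i > N.  Two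
   formal power series are equal if and only if all their truncations are. *)
Definition symfun := forall N : nat, {mpoly rat[N]}.

Definition proper_coloring (G : sgraph) N (kappa : {ffun G -> 'I_N}) : bool :=
  [forall x : G, forall y : G, adj x y ==> (kappa x != kappa y)].

Definition chromatic_symfun (G : sgraph) : symfun := fun N =>
  \sum_(kappa : {ffun G -> 'I_N} | proper_coloring kappa)
     \prod_(v : G) 'X_(kappa v).

Definition elem_symfun (lam : seq nat) : symfun := fun N =>
  \prod_(r <- lam) mesym N rat r.

Definition e_expansion (F : symfun) (c : {fsfun seq nat -> rat with 0}) : Prop :=
  (forall lam, lam \in finsupp c -> is_intpart lam) /\
  forall N, F N = \sum_(lam <- finsupp c) c lam *: elem_symfun lam N.

(* As (e_lam) is a basis, such a c exists and is unique for every graph. *)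
Definition e_positive (G : sgraph) : Prop :=
  exists c, e_expansion (chromatic_symfun G) c /\ forall lam, 0 <= c lam.

(* Main.v *)
Require Import Defs.
From mathcomp Require Import all_boot all_order all_algebra all_field.
From mathcomp Require Import finmap mpoly zify.

Set Implicit Arguments.
Unset Strict Implicit.
Unset Printing Implicit Defensive.

Import Order.TTheory GRing.Theory Num.Theory.

(** Both graphs arise from a connected graph H on n vertices by hanging a path
    on k vertices at each vertex.  In a connected partition all of whose parts
    have more than k vertices, a part meeting an arm contains the foot of that
    arm, since otherwise it would lie inside the arm.  Hence each part is a
    union of whole arms together with their feet, and its size is a multiple of
    k+1.  So the type with the two parts n(k+1) - (k+2) and k+2 does not occur
    ([pendant_no_two_part]).

    It remains to see that a connected graph G with d = a + b vertices that has
    no connected partition of type (a, b), where a and b are positive, is not e-positive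
    ([not_e_positive_of_two_part]).  Suppose that the chromatic symmetric
    function of G has an e-expansion with nonnegative coefficients c.  The
    coefficient of e_d is evaluated in two ways, each time by substituting
    multiples of roots of unity for the variables, so that the generating
    function of the elementary symmetric functions, the product of the
    1 + x_i Z, becomes very sparse.

    - Take x_i = rho z^i X, for z a primitive d-th root of unity and
      (-rho)^d = -1.  The product is 1 + X^d Z^d, so that only e_d contributes
      to the coefficient of X^d, and c(d) is, up to a nonzero factor, the sum
      of z^(sum of the colours) over the proper colourings of G by Z/d.  This
      sum is nonzero for connected G ([connected_coloring_sum_neq0]): summing
      over the colour of one vertex v turns it into minus a sum of similar sums
      over graphs with weighted vertices in which v has been merged into one of
      its neighbours, so by induction no two terms have opposite signs and
      some term is nonzero.

    - Take two blocks of colours, one of a colours with values rho z^i X,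
      for z of order a, and one of b colours with values tau t^j, for t of
      order b, where (-rho)^a = (-tau)^b = -1.  The product is (1 + X^a Z^a)(1 + Z^b), whence every e_lambda
      takes a value with nonnegative coefficients, and e_d takes the value X^a.
      The coefficient of X^a in the value of the chromatic function collects the colourings that use
      the first block on some set D of a vertices and the second block on its
      complement.  One of the two sets induces a disconnected graph, and
      rotating the colours on one side of a separation multiplies the sum for D
      by a root of unity other than 1; so this sum vanishes
      ([sum_class_eq0]).  A sum of nonnegative terms that vanishes has only
      zero terms, so c(d) = 0 ([e_coef_eq0]), a contradiction. *)

Local Open Scope nat_scope.
Local Open Scope ring_scope.

(** * Sums over proper colourings weighted by roots of unity *)

Definition is_proper (T : finType) (e : rel T) (C : finType)
    (kappa : {ffun T -> C}) : bool :=
  [forall x, forall y, e x y ==> (kappa x != kappa y)].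

Lemma is_properP (T : finType) (e : rel T) (C : finType) (kappa : {ffun T -> C}) :
  reflect (forall x y, e x y -> kappa x != kappa y) (is_proper e kappa).
Proof.
apply: (iffP forallP) => [h x y | h x].
  by move: (h x) => /forallP /(_ y) /implyP.
by apply/forallP => y; apply/implyP/h.
Qed.

Section RootsOfUnity.

Variables (R : idomainType) (N : nat) (z : R).
Hypothesis zP : N.-primitive_root z.

Lemma sum_prim_root_exp w : ~~ (N %| w)%N -> \sum_(c < N) z ^+ (w * c) = 0.
Proof.
rewrite (prim_order_dvd zP) => zw1.
have: (z ^+ w - 1) * \sum_(c < N) z ^+ (w * c) = 0.
  under eq_bigr do rewrite exprM.
  by rewrite -subrX1 -exprM mulnC exprM (prim_expr_order zP) expr1n subrr.
by move/eqP; rewrite mulf_eq0 subr_eq0 (negPf zw1) /= => /eqP.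
Qed.

(** With all weights 1 and #|T| = N, this is N times the coefficient of the
    power sum p_N in the chromatic symmetric function of (T, e); the weights
    record how many vertices have been merged into a given one. *)
Definition coloring_sum (T : finType) (e : rel T) (w : T -> nat) : R :=
  \sum_(kappa : {ffun T -> 'I_N} | is_proper e kappa)
     \prod_x z ^+ (w x * kappa x).

(** Vertex 0 is merged into its neighbour i.  The new edges from i to the
    smaller neighbours of 0 express that i is the least neighbour of 0 having
    its colour. *)
Definition merge_rel m (e : rel 'I_m.+1) (i : 'I_m) : rel 'I_m :=
  fun x y => [|| e (lift ord0 x) (lift ord0 y),
    [&& x == i, (y < i)%N & e ord0 (lift ord0 y)] |
    [&& y == i, (x < i)%N & e ord0 (lift ord0 x)]].

Definition merge_weight m (w : 'I_m.+1 -> nat) (i : 'I_m) : 'I_m -> nat :=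
  fun x => (w (lift ord0 x) + (x == i) * w ord0)%N.

Definition ffun_cons (C : finType) m (p : C * {ffun 'I_m -> C}) :
    {ffun 'I_m.+1 -> C} :=
  [ffun i => if unlift ord0 i is Some j then p.2 j else p.1].

Lemma ffun_cons_bij (C : finType) m : bijective (@ffun_cons C m).
Proof.
exists (fun f : {ffun 'I_m.+1 -> C} =>
          (f ord0, [ffun i => f (lift ord0 i)])) => [[c f]|f].
  by congr pair; [rewrite ffunE unlift_none|apply/ffunP=> i; rewrite !ffunE liftK].
by apply/ffunP => i; rewrite ffunE; case: unliftP => [j|] -> //=; rewrite ffunE.
Qed.

(** The sum over all colours vanishes, so the sum over the colours avoided by
    f on B is minus the sum over the colours taken there.  The least vertex of B
    of a given colour serves as an index for that colour. *)
Lemma sum_avoid m (f : {ffun 'I_m -> 'I_N}) (B : {set 'I_m}) w :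
  ~~ (N %| w)%N ->
  \sum_(c < N | [forall (i | i \in B), f i != c]) z ^+ (w * c) =
  - \sum_(i in B) if [forall (j : 'I_m | (j < i)%N && (j \in B)), f j != f i]
                  then z ^+ (w * f i) else 0.
Proof.
move=> Nw; apply/eqP; rewrite -addr_eq0; apply/eqP.
rewrite -[RHS](sum_prim_root_exp Nw).
rewrite [RHS](bigID (fun c => [forall (i | i \in B), f i != c])) /=.
congr (_ + _); rewrite -big_mkcondr /=.
set F := [set i in B | [forall (j : 'I_m | (j < i)%N && (j \in B)), f j != f i]].
have injF : {in F &, injective f}.
  move=> i j; rewrite !inE => /andP[iB /forall_inP hi] /andP[jB /forall_inP hj] fij.
  apply: val_inj; case: (ltngtP i j) => // lt; exfalso.
    by have := hj i; rewrite lt iB fij eqxx => /(_ isT).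
  by have := hi j; rewrite lt jB fij eqxx => /(_ isT).
transitivity (\sum_(i in F) z ^+ (w * f i)).
  by apply: eq_bigl => i; rewrite !inE.
rewrite -(big_imset (fun c : 'I_N => z ^+ (w * c)) injF).
apply: eq_bigl => c; rewrite negb_forall; apply/imsetP/existsP => [[i]|[i]].
  by rewrite inE => /andP[iB _] ->; exists i; rewrite iB /= eqxx.
rewrite negb_imply negbK => /andP[iB /eqP fic].
have Pi : [pred j | (j \in B) && (f j == c)] i by rewrite /= iB fic eqxx.
case: (arg_minnP (fun j : 'I_m => j : nat) Pi) => j /andP[jB /eqP fjc] jmin.
exists j => //; rewrite inE jB /=; apply/forall_inP => l /andP[lj lB].
apply/negP => /eqP flj.
by have := jmin l; rewrite /= lB flj fjc eqxx leqNgt lj => /(_ isT).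
Qed.

(** The colours forbidden for vertex 0 are those of its neighbours; [sum_avoid]
    replaces the sum over the allowed colours by one over the neighbours i whose
    colour is not taken by a smaller neighbour, and 0 then contributes as if it
    had the colour of i. *)
Lemma coloring_sum_step m (e : rel 'I_m.+1) (w : 'I_m.+1 -> nat) :
  ssrbool.symmetric e -> irreflexive e -> ~~ (N %| w ord0)%N ->
  coloring_sum e w =
  - \sum_(i < m | e ord0 (lift ord0 i))
       coloring_sum (merge_rel e i) (merge_weight w i).
Proof.
move=> esym eirr Nw; set B := [set i : 'I_m | e ord0 (lift ord0 i)].
pose g (f : {ffun 'I_m -> 'I_N}) := \prod_x z ^+ (w (lift ord0 x) * f x).
pose Q (f : {ffun 'I_m -> 'I_N}) := is_proper (relpre (lift ord0) e) f.
have eqcons c f : is_proper e (ffun_cons (c, f)) =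
    Q f && [forall (i | i \in B), f i != c].
  apply/is_properP/andP => [h|[/is_properP hf /forall_inP hc] x y].
    split; first by apply/is_properP => x y /h; rewrite !ffunE !liftK.
    apply/forall_inP => i; rewrite inE => /h.
    by rewrite !ffunE liftK unlift_none eq_sym.
  rewrite !ffunE; case: unliftP => [i|] ->; case: unliftP => [j|] -> /=.
  - exact: hf.
  - by move=> ei; apply: hc; rewrite inE esym.
  - by move=> ei; rewrite eq_sym; apply: hc; rewrite inE.
  - by rewrite eirr.
rewrite /coloring_sum (reindex _ (onW_bij _ (ffun_cons_bij _ _))) /=.
rewrite (eq_bigl (fun p => Q p.2 &&
   [forall (i | i \in B), p.2 i != p.1])) => [|[c f]]; last exact: eqcons.
rewrite (eq_bigr (fun p : 'I_N * {ffun _} =>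
  g p.2 * z ^+ (w ord0 * p.1))) => [|[c f] _]; last first.
  rewrite big_ord_recl mulrC ffunE unlift_none /=; congr (_ * _).
  by apply: eq_bigr => i _; rewrite ffunE liftK.
rewrite -(pair_big_dep xpredT (fun c f => Q f &&
   [forall (i | i \in B), f i != c]) (fun (c : 'I_N) f => g f * z ^+ (w ord0 * c))) /=.
rewrite (exchange_big_dep (Q)) /=; last first.
  by move=> c f _ /andP[].
transitivity (\sum_(f | Q f) - \sum_(i in B)
  (if [forall (j : 'I_m | (j < i)%N && (j \in B)), f j != f i]
                  then g f * z ^+ (w ord0 * f i) else 0)).
  apply: eq_bigr => f hf; rewrite (eq_bigl (fun c =>
    [forall (i | i \in B), f i != c])) => [|c]; last by rewrite hf.
  rewrite -mulr_sumr sum_avoid // mulrN mulr_sumr; congr (- _).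
  by apply: eq_bigr => i _; case: ifP => // _; rewrite mulr0.
rewrite sumrN exchange_big /=; congr (- _).
rewrite (eq_bigl (fun i => e ord0 (lift ord0 i))) => [|i]; last by rewrite inE.
apply: eq_bigr => i ei; rewrite -big_mkcondr /=; apply: eq_big => f.
  apply/andP/is_properP => [[/is_properP hf /forall_inP hi] x y|h].
    case/or3P => [/hf //|/and3P[/eqP-> yi ey]|/and3P[/eqP-> xi ex]].
      by rewrite eq_sym; apply: hi; rewrite yi inE.
    by apply: hi; rewrite xi inE.
  split; first by apply/is_properP => x y exy; apply: h; rewrite /merge_rel [e _ _]exy.
  apply/forall_inP => j /andP[ji]; rewrite inE => ej; apply: h.
  by rewrite /merge_rel eqxx ji ej !orbT.
move=> _; rewrite /merge_weight.
under [RHS]eq_bigr do rewrite mulnDl exprD.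
rewrite big_split /=; congr (_ * _).
rewrite (bigD1 i) //= eqxx mul1n big1 ?mulr1 // => j /negPf->.
by rewrite mul0n.
Qed.

End RootsOfUnity.

Lemma connect_hom (T U : finType) (e : rel T) (e' : rel U) (f : T -> U) :
  (forall x y, e x y -> connect e' (f x) (f y)) ->
  forall x y, connect e x y -> connect e' (f x) (f y).
Proof.
move=> h x _ /connectP[p + ->]; elim: p x => [|y p IHp] x /=.
  by rewrite connect0.
by case/andP => /h exy /IHp; apply: connect_trans.
Qed.

(** Each elimination step changes the sign, and a single vertex of weight N
    gives N > 0.  For a connected graph, merging 0 into its greatest neighbour i
    keeps the graph connected, because i becomes adjacent to all the other
    neighbours of 0; so one term is positive. *)
Lemma coloring_sum_sign (N : nat) (z : algC) : N.-primitive_root z ->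
  forall m (e : rel 'I_m.+1) (w : 'I_m.+1 -> nat),
  ssrbool.symmetric e -> irreflexive e -> (forall x, 0 < w x)%N ->
  (\sum_x w x)%N = N ->
  0 <= (-1) ^+ m * coloring_sum N z e w /\
  ((forall x y, connect e x y) -> 0 < (-1) ^+ m * coloring_sum N z e w).
Proof.
move=> zP; elim=> [|m IHm] e w esym eirr wpos wN.
  suff -> : coloring_sum N z e w = N%:R.
    by rewrite mul1r ler0n ltr0n (prim_order_gt0 zP).
  rewrite /coloring_sum (reindex _ (onW_bij _ (ffun_cons_bij _ _))) /=.
  rewrite (eq_bigl xpredT); last first.
    by move=> f; apply/is_properP => x y; rewrite !ord1 eirr.
  rewrite (eq_bigr (fun=> 1)) => [|f _]; last first.
    move: wN; rewrite !big_ord_recl !big_ord0 mulr1 addn0 => ->.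
    by rewrite exprM (prim_expr_order zP) expr1n.
  by rewrite sumr_const card_prod card_ord card_ffun !card_ord expn0 muln1.
(* The other vertices have positive weight, so 0 < w ord0 < N. *)
have Nw : ~~ (N %| w ord0)%N.
  apply/negP => /(dvdn_leq (wpos _)); apply/negP; rewrite -ltnNge -wN.
  by rewrite big_ord_recl [in X in (_ < _ + X)%N]big_ord_recl
    -[X in (X < _)%N]addn0 ltn_add2l addn_gt0 wpos.
rewrite (coloring_sum_step zP esym eirr Nw) exprS mulN1r mulrNN mulr_sumr.
have mnat i : 0 <= (-1) ^+ m *
    coloring_sum N z (merge_rel e i) (merge_weight w i) /\
  ((forall x y, connect (merge_rel e i) x y) -> 0 < (-1) ^+ m *
    coloring_sum N z (merge_rel e i) (merge_weight w i)).
  apply: IHm.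
  - by move=> x y; rewrite /merge_rel esym [X in _ || X]orbC.
  - move=> x; rewrite /merge_rel eirr /= orbb.
    by apply/negP => /and3P[/eqP-> ]; rewrite ltnn.
  - by move=> x; rewrite /merge_weight addn_gt0 wpos.
  - rewrite -wN [RHS]big_ord_recl big_split /= addnC; congr (_ + _)%N.
    by rewrite (bigD1 i) //= eqxx mul1n big1 ?addn0 // => j /negPf->.
split=> [|econn]; first by apply: sumr_ge0 => i _; case: (mnat i).
have [i0 ei0] : exists i, e ord0 (lift ord0 i).
  have /connectP[[|y p]] := econn ord0 (lift ord0 ord0); first by move=> _ /eqP.
  move=> /= /andP[ey _] _; case: (unliftP ord0 y) ey => [j|] -> ey.
    by exists j.
  by rewrite eirr in ey.
case: (@arg_maxnP _ i0 (fun j => e ord0 (lift ord0 j))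
  (fun j => j : nat) ei0) => i ei imax.
rewrite (bigD1 i) //=; apply: ltr_wpDr; first by apply: sumr_ge0 => j _; case: (mnat j).
case: (mnat i) => _; apply.
pose f (x : 'I_m.+2) := if unlift ord0 x is Some j then j else i.
suff fh u v : e u v -> connect (merge_rel e i) (f u) (f v).
  move=> x y; have := connect_hom fh (econn (lift ord0 x) (lift ord0 y)).
  by rewrite /f !liftK.
have to0 j : e ord0 (lift ord0 j) -> connect (merge_rel e i) i j /\
    connect (merge_rel e i) j i.
  move=> ej; have : (j <= i)%N := imax j ej; rewrite leq_eqVlt => /predU1P[/val_inj->|ji].
    by rewrite connect0.
  by split; apply: connect1; rewrite /merge_rel eqxx ji ej !orbT.
rewrite /f; case: unliftP => [x|] ->; case: unliftP => [y|] -> euv.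
- by apply: connect1; rewrite /merge_rel euv.
- by apply: (to0 x _).2; rewrite esym.
- exact: (to0 y _).1.
- exact: connect0.
Qed.

(** * Specialisations of the elementary symmetric functions *)

Definition elem_gen (R : comNzRingType) M (x : 'I_M -> R) : {poly R} :=
  \prod_i (1 + x i *: 'X).

Lemma coef_elem_gen (R : comNzRingType) M (x : 'I_M -> R) r :
  (elem_gen x)`_r = \sum_(h : {set 'I_M} | #|h| == r) \prod_(i in h) x i.
Proof.
rewrite /elem_gen; under eq_bigr do rewrite addrC.
rewrite bigA_distr coef_sum [RHS]big_mkcond; apply: eq_bigr => h _.
have -> : \prod_i (if i \in h then x i *: 'X else 1) =
    (\prod_(i in h) x i) *: 'X^#|h| :> {poly R}.
  by rewrite -big_mkcond /= scaler_prod prodr_const.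
by rewrite coefZ coefXn eq_sym; case: eqP; rewrite ?mulr1 ?mulr0.
Qed.

Lemma mmap_elem_symfun (R : comNzRingType) (f : {rmorphism rat -> R}) M
    (x : 'I_M -> R) lam :
  mmap f x (elem_symfun lam M) = \prod_(r <- lam) (elem_gen x)`_r.
Proof.
rewrite /elem_symfun rmorph_prod; apply: eq_bigr => r _ /=.
rewrite /mesym rmorph_sum coef_elem_gen; apply: eq_bigr => h _.
by rewrite rmorph_prod; apply: eq_bigr => i _ /=; rewrite mmapX mmap1U.
Qed.

Lemma mmap_chromatic_symfun (R : comNzRingType) (f : {rmorphism rat -> R}) M
    (x : 'I_M -> R) (G : sgraph) :
  mmap f x (chromatic_symfun G M) =
  \sum_(kappa : {ffun G -> 'I_M} | is_proper (@adj G) kappa) \prod_v x (kappa v).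
Proof.
rewrite /chromatic_symfun rmorph_sum; apply: eq_bigr => kappa _.
by rewrite rmorph_prod; apply: eq_bigr => v _ /=; rewrite mmapX mmap1U.
Qed.

Lemma mmap_e_expansion (R : comNzRingType) (f : {rmorphism rat -> R}) M
    (x : 'I_M -> R) F c :
  e_expansion F c ->
  mmap f x (F M) =
  \sum_(lam <- finsupp c) f (c lam) * \prod_(r <- lam) (elem_gen x)`_r.
Proof.
case=> _ ->; rewrite rmorph_sum; apply: eq_bigr => lam _ /=.
by rewrite mmapZ mmap_elem_symfun.
Qed.

(** * Variables specialised to multiples of roots of unity *)

Lemma prod_one_sub_prim_root (n : nat) (z : algC) : n.-primitive_root z ->
  \prod_(i < n) (1 - z ^+ i *: 'X) = 1 - 'X^n.
Proof.
move=> zP; have n0 := prim_order_gt0 zP.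
(* z ^+ n.-1 is the inverse of z, whose powers are the roots in 'X of the
   factors of the product. *)
have uP : n.-primitive_root (z ^+ n.-1).
  by rewrite (prim_root_exp_coprime _ zP) coprime_sym coprimenP.
have := factor_Xn_sub_1 uP; rewrite big_mkord => h.
have zu i : z ^+ i * (z ^+ n.-1) ^+ i = 1.
  by rewrite -exprMn -exprS prednK // (prim_expr_order zP) expr1n.
have prodE : \prod_(i < n) (1 - z ^+ i *: 'X) =
    (\prod_(i < n) - z ^+ i) *: ('X^n - 1 : {poly algC}).
  rewrite -h -scaler_prod; apply: eq_bigr => i _.
  by rewrite scalerBr !scaleNr opprK scale_polyC zu polyC1 addrC.
(* The constant in front is found by evaluating at 0. *)
have := congr1 (horner^~ 0) prodE.
rewrite hornerZ !hornerE horner_prod big1 => [|i _]; last first.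
  by rewrite !hornerE ?subr0.
rewrite expr0n gtn_eqF //= add0r mulrN1 => K.
by rewrite prodE -[X in X *: _]opprK -K scaleN1r opprB.
Qed.

(** The factor rho, with (- rho) ^+ n = -1, makes the sign of the n-th elementary
    symmetric function positive; y is a scale by which blocks of variables can be
    told apart. *)
Lemma root_colors n : (0 < n)%N ->
  exists z rho : algC, [/\ n.-primitive_root z, rho != 0 &
    forall (y : {poly algC}),
      elem_gen (fun i : 'I_n => (rho * z ^+ i)%:P * y) = 1 + y ^+ n *: 'X^n].
Proof.
move=> n0; have [z zP] := C_prim_root_exists n0.
pose rho := - n.-root (-1 : algC).
have rhon : (- rho) ^+ n = -1 by rewrite opprK rootCK.
clearbody rho.
exists z, rho; split=> // [|y].
  by apply: contra_eq_neq rhon => ->; rewrite oppr0 expr0n gtn_eqF // eq_sym oppr_eq0 oner_eq0.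
have /(congr1 (fun p => map_poly polyC p \Po (((- rho)%:P * y) *: 'X))) :=
  prod_one_sub_prim_root zP.
rewrite !rmorph_prod rmorphB rmorph1 rmorphB rmorph1 /= map_polyXn.
rewrite comp_Xn_poly exprZn.
have -> : ((- rho)%:P * y) ^+ n = - y ^+ n.
  by rewrite exprMn -polyC_exp rhon polyCN polyC1 mulN1r.
rewrite scaleNr opprK.
move=> <-; apply: eq_bigr => i _; rewrite !rmorphB !rmorph1 /=; congr (_ + _).
rewrite map_polyZ map_polyX /= comp_polyZ comp_polyX scalerA -scaleNr; congr (_ *: _).
by rewrite mulrA -polyCM -mulNr -polyCN mulrN opprK [_ * rho]mulrC.
Qed.

(** Applying s to the colours on S maps the proper colourings of class D to
    themselves: an edge leaving S ends outside D, so its ends have colours of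
    different classes before and after.  This multiplies each summand by
    z ^+ #|S|, which differs from 1. *)
Lemma sum_class_eq0 (T C : finType) (e : rel T) (R : idomainType) (x : C -> R)
    (A : pred C) (s : C -> C) (z : R) (D S : {set T}) :
  ssrbool.symmetric e ->
  injective s -> (forall c, A (s c) = A c) ->
  (forall c, A c -> x (s c) = z * x c) ->
  S \subset D -> (forall u v, u \in S -> v \in D :\: S -> ~~ e u v) ->
  z ^+ #|S| != 1 ->
  \sum_(kappa : {ffun T -> C} | is_proper e kappa && ([set v | A (kappa v)] == D))
    \prod_v x (kappa v) = 0.
Proof.
move=> esym sinj sA sx SD eS zS.
pose sh (f : {ffun T -> C}) : {ffun T -> C} := [ffun v => if v \in S then s (f v) else f v].
have shinj : injective sh.
  move=> f g /ffunP fg; apply/ffunP => v; have := fg v; rewrite !ffunE.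
  by case: ifP => // _ /sinj.
have shA f v : A (sh f v) = A (f v) by rewrite ffunE; case: ifP.
have shset f : [set v | A (sh f v)] = [set v | A (f v)].
  by apply/setP => v; rewrite !inE shA.
have shP (f : {ffun T -> C}) : [set v | A (f v)] = D -> is_proper e (sh f) = is_proper e f.
  move=> fD; have cross u v : u \in S -> v \notin S -> e u v -> s (f u) != f v /\ f u != f v.
    move=> uS vS euv; have := eS u v uS; rewrite inE vS -fD inE => /contraTN /(_ euv) fvA.
    have fuA : A (f u) by have := subsetP SD u uS; rewrite -fD inE.
    by split; apply: contraNneq fvA => <-; rewrite ?sA.
  apply/is_properP/is_properP => h u v euv; have := h u v euv; rewrite !ffunE;
    case: ifP => uS; case: ifP => vS //.
  - by rewrite (inj_eq sinj).
  - by move=> _; case: (cross u v uS (negbT vS) euv).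
  - by move=> _; rewrite eq_sym; case: (cross v u vS (negbT uS)); rewrite // esym.
  - by rewrite (inj_eq sinj).
  - by move=> _; case: (cross u v uS (negbT vS) euv).
  - by move=> _; rewrite eq_sym; case: (cross v u vS (negbT uS)); rewrite // esym.
set sigma := \sum_(_ | _) _.
suff /eqP : sigma = z ^+ #|S| * sigma.
  by rewrite eq_sym -subr_eq0 -[X in _ - X]mul1r -mulrBl mulf_eq0 subr_eq0
    (negPf zS) /= => /eqP.
rewrite {1}/sigma (reindex_inj shinj) mulr_sumr.
apply: eq_big => f.
  by rewrite shset; case: eqP => [fD|_]; rewrite ?andbF // shP.
case/andP => _; rewrite shset => /eqP fD.
rewrite (bigID (mem S)) [in RHS](bigID (mem S)) /= mulrA -prodr_const -big_split /=.
congr (_ * _); apply: eq_bigr => v vS; rewrite ffunE ?vS ?(negPf vS) // sx //.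
by have := subsetP SD v vS; rewrite -fD inE.
Qed.

Lemma connected_or_split (G : sgraph) (D : {set G}) : D != set0 ->
  connected (induced D) \/ exists S : {set G},
    [/\ S \subset D, (0 < #|S| < #|D|)%N &
        forall u v, u \in S -> v \in D :\: S -> ~~ adj u v].
Proof.
move=> /set0Pn[d dD]; pose H := induced D.
have H0 : (0 < #|H|)%N by apply/card_gt0P; exists (exist _ d dD : H).
case: (boolP [forall x : H, forall y : H, connect (@adj H) x y]) => [/forallP h|].
  by left; split=> // x y; move/forallP: (h x).
rewrite negb_forall => /existsP[x]; rewrite negb_forall => /existsP[y nxy]; right.
pose S := [set val u | u in [set u : H | connect (@adj H) x u]].
have SD : S \subset D by apply/subsetP => _ /imsetP[u _ ->]; exact: valP.
have xS : val x \in S by apply: imset_f; rewrite inE connect0.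
have yS : val y \notin S.
  by apply/imsetP => -[u]; rewrite inE => xu /val_inj yu; rewrite yu xu in nxy.
exists S; split=> // [|_ v /imsetP[u + ->] /setDP[vD]].
  apply/andP; split; first by apply/card_gt0P; exists (val x).
  by apply: proper_card; apply/properP; split=> //; exists (val y); first exact: valP.
rewrite inE => xu; apply: contra => uv.
apply/imsetP; exists (exist _ v vD : H) => //; rewrite inE.
by apply: connect_trans xu (connect1 _).
Qed.

(** * The coefficient of e_d for a connected graph with d vertices *)

Lemma coloring_sum_bij (N : nat) (z : algC) (T U : finType) (f : U -> T)
    (e : rel T) (w : T -> nat) :
  bijective f ->
  coloring_sum N z (relpre f e) (w \o f) = coloring_sum N z e w.
Proof.
move=> [g fK gK].
pose pull (kappa : {ffun T -> 'I_N}) : {ffun U -> 'I_N} := [ffun u => kappa (f u)].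
have pull_bij : bijective pull.
  exists (fun l : {ffun U -> 'I_N} => [ffun t => l (g t)]) => l;
    by apply/ffunP => t; rewrite !ffunE ?fK ?gK.
rewrite /coloring_sum (reindex _ (onW_bij _ pull_bij)) /=.
apply: eq_big => [kappa|kappa _].
  apply/is_properP/is_properP => h x y exy.
    by have := h (g x) (g y); rewrite /= !ffunE !gK; apply.
  by rewrite !ffunE; apply: h.
rewrite [RHS](reindex f) /=; last by exists g => x _; rewrite ?fK ?gK.
by apply: eq_bigr => u _; rewrite ffunE.
Qed.

Lemma connected_coloring_sum_neq0 (G : sgraph) (z : algC) :
  connected G -> #|G|.-primitive_root z ->
  coloring_sum #|G| z (@adj G) (fun=> 1%N) != 0.
Proof.
move=> [G0 Gconn] zP.
have [m cardG] : exists m, #|G| = m.+1 by exists #|G|.-1; rewrite prednK.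
pose f (i : 'I_m.+1) : G := enum_val (cast_ord (esym cardG) i).
pose g (v : G) : 'I_m.+1 := cast_ord cardG (enum_rank v).
have fK : cancel f g by move=> i; rewrite /f /g enum_valK cast_ordKV.
have gK : cancel g f by move=> v; rewrite /f /g cast_ordK enum_rankK.
have fbij : bijective f by exists g.
rewrite -(coloring_sum_bij _ z (@adj G) (fun=> 1%N) fbij).
have [||||_ pos] := coloring_sum_sign zP (e := relpre f (@adj G)) (w := fun=> 1%N).
- by move=> x y /=; rewrite adj_sym.
- by move=> x /=; rewrite adj_irr.
- by [].
- by rewrite sum1_card card_ord.
have {}pos : 0 < (-1) ^+ m *
    coloring_sum #|G| z (relpre f (@adj G)) ((fun=> 1%N) \o f).
  apply: pos => x y; rewrite -[x]fK -[y]fK.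
  apply: connect_hom (Gconn (f x) (f y)) => u v uv.
  by apply: connect1; rewrite /= !gK.
by apply: contraTneq pos => ->; rewrite mulr0 ltxx.
Qed.

Lemma prod_coef_binomial (R : comNzRingType) N (y : R) (lam : seq nat) :
  (0 < N)%N -> 0%N \notin lam ->
  \prod_(r <- lam) (1 + y *: 'X^N)`_r =
  if all (pred1 N) lam then y ^+ size lam else 0.
Proof.
move=> N0; elim: lam => [|r lam IH]; first by rewrite big_nil.
rewrite inE negb_or eq_sym big_cons /= => /andP[r0 /IH ->].
rewrite coefD coef1 coefZ coefXn (negPf r0) add0r.
by case: eqP => _ /=; rewrite ?mulr0 ?mul0r // mulr1; case: ifP; rewrite ?mulr0 // exprS.
Qed.

(** Under x_i = rho z^i X the function e_lambda becomes X^(N * size lambda) if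
    all parts of lambda are N, and 0 otherwise; so the coefficient of X^N sees
    only lambda = (N). *)
Lemma e_coef_connected_neq0 (G : sgraph) c :
  connected G -> e_expansion (chromatic_symfun G) c -> c [:: #|G|] != 0.
Proof.
move=> Gconn cP; set N := #|G|; have N0 : (0 < N)%N := Gconn.1.
have [z [rho [zP rho0 gen]]] := root_colors N0.
apply/eqP => cN0.
have := mmap_e_expansion (polyC \o ratr)
  (fun i : 'I_N => (rho * z ^+ i)%:P * 'X) cP.
rewrite gen mmap_chromatic_symfun => /(congr1 (fun p : {poly algC} => p`_N)).
rewrite [RHS]coef_sum [RHS]big_seq [RHS]big1 => [|lam lamc]; last first.
  have /andP[_ lam0] := cP.1 lam lamc.
  rewrite /= coefCM prod_coef_binomial //; case: ifP => [/all_pred1P lamE|]; last first.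
    by rewrite coef0 mulr0.
  rewrite -exprM coefXn -{1}[N]muln1 eqn_pmul2l // eq_sym.
  case: eqP => [lam1|]; rewrite ?mulr0 // mulr1.
  by rewrite lamE lam1 cN0 rmorph0.
apply/eqP; set X := \sum_(kappa | _) _.
suff -> : X`_N = rho ^+ N * coloring_sum N z (@adj G) (fun=> 1%N).
  by rewrite mulf_neq0 ?expf_neq0 ?connected_coloring_sum_neq0.
rewrite coef_sum /coloring_sum mulr_sumr; apply: eq_bigr => kappa _.
rewrite big_split /= prodr_const -/N -rmorph_prod coefCM coefXn eqxx mulr1.
rewrite big_split /= prodr_const; congr (_ * _).
by apply: eq_bigr => v _; rewrite mul1n.
Qed.

(** * Connected partitions with two parts *)

Definition nonneg_coefs (p : {poly algC}) := forall i, 0 <= p`_i.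

Lemma nonneg_coefs_nat n : nonneg_coefs n%:R.
Proof. by move=> i; rewrite -polyC_natr coefC; case: eqP; rewrite ?ler0n. Qed.

Lemma nonneg_coefsM p q :
  nonneg_coefs p -> nonneg_coefs q -> nonneg_coefs (p * q).
Proof. by move=> p0 q0 i; rewrite coefM sumr_ge0 // => j _; rewrite mulr_ge0. Qed.

(** Both sides of the e-expansion are specialised to the two blocks of colours,
    those of the first block being the multiples of X.  The coefficient of X^a
    vanishes on the left, and on the right it is a sum of nonnegative terms
    among which is c (a + b). *)
Lemma e_coef_eq0 (G : sgraph) c a b :
  (0 < a)%N -> (0 < b)%N -> (a + b)%N = #|G| ->
  (forall D : {set G}, #|D| = a ->
     ~ (connected (induced D) /\ connected (induced (~: D)))) ->
  e_expansion (chromatic_symfun G) c -> (forall lam, 0 <= c lam) ->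
  c [:: (a + b)%N] = 0.
Proof.
move=> a0 b0 abG noconn cP cpos.
have [z [rho [zP rho0 genA]]] := root_colors a0.
have [t [tau [tP tau0 genB]]] := root_colors b0.
pose x (i : 'I_(a + b)) : {poly algC} := match split i with
  | inl j => (rho * z ^+ j)%:P * 'X
  | inr j => (tau * t ^+ j)%:P end.
pose A (i : 'I_(a + b)) := if split i is inl _ then true else false.
have xl j : x (lshift b j) = (rho * z ^+ j)%:P * 'X.
  by rewrite /x (unsplitK (inl j)).
have xr j : x (rshift a j) = (tau * t ^+ j)%:P.
  by rewrite /x (unsplitK (inr j)).
have gen : elem_gen x = (1 + 'X ^+ a *: 'X^a) * (1 + 'X^b).
  rewrite /elem_gen big_split_ord /=; congr (_ * _).
    by rewrite -genA; apply: eq_bigr => i _; rewrite xl.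
  have := genB 1; rewrite expr1n scale1r => <-.
  by apply: eq_bigr => i _; rewrite xr mulr1.
have := mmap_e_expansion (polyC \o ratr) x cP.
rewrite gen mmap_chromatic_symfun => /(congr1 (fun p : {poly algC} => p`_a)).
rewrite coef_sum (partition_big (fun kappa : {ffun G -> _} => [set v | A (kappa v)])
  xpredT) //= big1 => [|D _]; last first.
  (* The degree in X is the number of vertices coloured from the first block. *)
  have [Da|Da] := eqVneq #|D| a; last first.
    apply: big1 => kappa /andP[_ /eqP kD].
    suff -> : \prod_v x (kappa v) =
      (\prod_v (match split (kappa v) with
        inl j => rho * z ^+ j | inr j => tau * t ^+ j end))%:P * 'X^#|D|.
      by rewrite coefCM coefXn eq_sym (negPf Da) mulr0.
    rewrite -kD cardsE -prodr_const [\prod_(v in _) 'X]big_mkcond rmorph_prod -big_split /=.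
    apply: eq_bigr => v _; rewrite /x unfold_in /A; case: split => j //.
    by rewrite mulr1.
  rewrite -coef_sum.
  have cD : #|~: D| = b.
    by apply/eqP; rewrite -(eqn_add2l #|D|) cardsC Da abG.
  pose rot (p : bool) (i : 'I_(a + b)) := unsplit (match split i with
    | inl j => if p then inl (ordS j) else inl j
    | inr j => if p then inr j else inr (ordS j) end).
  have rotI p : injective (rot p).
    apply: (can_inj (g := fun i => unsplit (match split i with
      | inl j => if p then inl (ord_pred j) else inl j
      | inr j => if p then inr j else inr (ord_pred j) end))) => i.
    rewrite /rot unsplitK -[RHS]splitK; congr (unsplit _).
    by case: (split i) => j; case: p; rewrite ?ordSK.
  have rotA p i : A (rot p i) = A i.
    by rewrite /A /rot unsplitK; case: split => j; case: p.
  set Y := \sum_(kappa | _) _; suff -> : Y = 0 by rewrite coef0.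
  rewrite {}/Y.
  have D0 : D != set0 by rewrite -card_gt0 Da.
  have DC0 : ~: D != set0 by rewrite -card_gt0 cD.
  have [Dconn|[S [SD /andP[S0 SDlt] Se]]] := connected_or_split D0.
  - have [DCconn|[S [SD /andP[S0 SDlt] Se]]] := connected_or_split DC0.
      by case: (noconn D Da).
    rewrite (eq_bigl (fun kappa : {ffun G -> 'I_(a + b)} => is_proper (@adj G) kappa &&
        ([set v | ~~ A (kappa v)] == ~: D))) => [|kappa]; last first.
      congr (_ && _); rewrite -(inj_eq (can_inj (@setCK G))); congr (_ == _);
        last by rewrite setCK.
      by apply/setP => v; rewrite !inE negbK.
    apply: (@sum_class_eq0 _ _ _ _ x (fun i => ~~ A i) (rot false) t%:P (~: D) S)
      => //.
    + exact: adj_sym.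
    + by move=> i; rewrite rotA.
    + move=> i; rewrite /A /x /rot unsplitK; case: split => j //= _.
      by rewrite -polyCM (prim_expr_mod tP) exprS mulrCA.
    + rewrite -polyC_exp -polyC1 (inj_eq polyC_inj) -(prim_order_dvd tP).
      by apply/negP => /(dvdn_leq S0); rewrite leqNgt -cD SDlt.
  apply: (@sum_class_eq0 _ _ _ _ x A (rot true) z%:P D S) => //.
  - exact: adj_sym.
  - move=> i; rewrite /A /x /rot unsplitK; case: split => j //= _.
    by rewrite mulrA -polyCM (prim_expr_mod zP) exprS mulrCA.
  - rewrite -polyC_exp -polyC1 (inj_eq polyC_inj) -(prim_order_dvd zP).
    by apply/negP => /(dvdn_leq S0); rewrite leqNgt -Da SDlt.
(* The left-hand side is now 0. *)
rewrite coef_sum => /esym/eqP; rewrite psumr_eq0 => [/allP h|lam _]; last first.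
  rewrite /= coefCM mulr_ge0 ?ler0q ?cpos //.
  suff h : nonneg_coefs (\prod_(r <- lam) ((1 + 'X ^+ a *: 'X^a) * (1 + 'X^b))`_r)
    by exact: h.
  apply: (big_ind (@nonneg_coefs)) => [i|p q|r _]; first exact: nonneg_coefs_nat 1%N i.
    exact: nonneg_coefsM.
  have nnA i : nonneg_coefs (1 + 'X ^+ a *: 'X^a : {poly {poly algC}})`_i.
    move=> j; rewrite coefD coef1 coefZ coefXn coefD addr_ge0 ?nonneg_coefs_nat //.
    by apply: nonneg_coefsM; [move=> l; rewrite coefXn ler0n|exact: nonneg_coefs_nat].
  move=> i; rewrite mulrDr mulr1 coefD coefMXn coefD addr_ge0 ?nnA //.
  by case: ifP; rewrite ?coef0 ?nnA.
apply/eqP; apply: contraT => cN.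
have := h [:: (a + b)%N]; rewrite mem_finsupp cN => /(_ isT) /=.
rewrite big_seq1 mulrDr mulr1 coefD coefMXn addnK ltnNge leq_addl /=.
rewrite !coefD !coef1 !coefZ !coefXn addn_eq0 !(gtn_eqF a0) /=.
rewrite -[X in (a + b)%N == X]addn0 eqn_add2l (gtn_eqF b0) eqxx mulr0 mulr1 !add0r.
by rewrite coefCM coefXn eqxx mulr1 fmorph_eq0 (negPf cN).
Qed.

Lemma not_e_positive_of_two_part (G : sgraph) a b :
  connected G -> (0 < b <= a)%N -> (a + b)%N = #|G| ->
  ~ has_connected_partition G [:: a; b] -> ~ e_positive G.
Proof.
move=> Gconn /andP[b0 ba] abG nocp [c [cP cpos]].
have a0 := leq_trans b0 ba.
have := e_coef_connected_neq0 Gconn cP; rewrite -abG => /eqP; apply.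
apply: (e_coef_eq0 a0 b0 abG _ cP cpos) => D Da [Dconn DCconn]; apply: nocp.
have D0 : D != set0 by rewrite -card_gt0 Da.
have cD : #|~: D| = b by apply/eqP; rewrite -(eqn_add2l #|D|) cardsC Da abG.
have DC0 : ~: D != set0 by rewrite -card_gt0 cD.
have DDC : D != ~: D.
  by apply: contraNneq D0 => DE; rewrite -[D]setIid {2}DE setICr.
exists [set D; ~: D]; split; first split.
- apply/and3P; split.
  + by rewrite /cover bigcup_setU !big_set1 setUCr.
  + apply/trivIsetP => B C; rewrite !inE => /orP[]/eqP-> /orP[]/eqP->;
      by rewrite ?eqxx // => _; rewrite -setI_eq0 ?setICr // setIC setICr.
  + by rewrite !inE negb_or ![set0 == _]eq_sym D0.
- by move=> B; rewrite !inE => /orP[]/eqP->.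
have geq_trans : transitive geq by move=> x y w xy yw; apply: leq_trans yw xy.
have geq_anti : antisymmetric geq by move=> x y; rewrite andbC; apply: anti_leq.
have geq_total : total geq by move=> x y; apply: leq_total.
apply: (sorted_eq geq_trans geq_anti).
- exact: sort_sorted.
- by rewrite /= andbT.
rewrite perm_sort; apply: (perm_trans (y := [seq #|B : {set G}| | B <- [:: D; ~: D]])).
  apply/perm_map/uniq_perm; rewrite ?enum_uniq //= ?inE ?DDC //.
  by move=> B; rewrite mem_enum !inE.
by rewrite /= Da cD.
Qed.

(** * Graphs with pendant paths of equal length *)

Section Pendant.

Variables (H : sgraph) (k : nat).
Let G := @pendant_graph H (fun=> k).

Definition foot (x : G) : H := match x with inl v => v | inr p => tag p end.

Lemma card_foot_preim (A : {set H}) : #|[set x : G | foot x \in A]| = (#|A| * k.+1)%N.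
Proof.
have -> : [set x : G | foot x \in A] =
    [set inl v | v in A] :|:
    [set inr (existT (fun=> 'I_k) p.1 p.2) | p in setX A [set: 'I_k]] :> {set G}.
  apply/setP => -[v|[v j]]; rewrite !inE /=.
    rewrite mem_imset; last by move=> ? ? [].
    by case: (v \in A) => //; apply/esym/imsetP => -[].
  apply/idP/orP => [vA|[/imsetP[] //|/imsetP[[u i]]]].
    by right; apply/imsetP; exists (v, j); rewrite ?inE ?vA.
  by rewrite !inE /= andbT => uA [->].
rewrite cardsU (_ : _ :&: _ = set0) ?cards0 ?subn0; last first.
  by apply/setP => x; rewrite !inE; apply/andP => -[/imsetP[v _ ->] /imsetP[]].
rewrite card_imset; last by move=> ? ? [].
rewrite card_imset ?cardsX ?cardsT ?card_ord ?mulnS //.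
by move=> [u i] [v j] [-> ->].
Qed.

(** The foot of an arm separates that arm from the rest of the graph. *)
Lemma connected_in_arm (B : {set G}) x :
  connected (induced B) -> x \in B -> inl (foot x) \notin B -> (#|B| <= k)%N.
Proof.
move=> [_ Bconn] xB fB; case: x => [v|[v j]] /= in xB fB *.
  by rewrite xB in fB.
suff Bsub : B \subset [set inr (existT (fun=> 'I_k) v i) | i in [set: 'I_k]].
  apply: leq_trans (subset_leq_card Bsub) _.
  by rewrite (leq_trans (leq_imset_card _ _)) // cardsT card_ord.
pose a (y : induced B) := if val y is inr p then tag p == v else false.
have a_closed : closed (@adj (induced B)) a.
  apply: intro_closed; first by apply: sym_connect_sym => y z; rewrite adj_sym.
  move=> [[u|[u i]] yB] [[w|[w l]] zB]; rewrite /a unfold_in /= unfold_in //=.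
    by case/andP => /eqP uw _ /eqP uv; rewrite -uw uv (negPf fB) in zB.
  by case/andP => /eqP ->.
apply/subsetP => y yB.
pose s (z : G) (zB : z \in B) : induced B := exist _ z zB.
have := closed_connect a_closed (Bconn (s _ xB) (s y yB)).
rewrite /a /in_mem /= eqxx; case: y yB => [//|[u i] _] /= /esym /eqP ->.
by apply: imset_f; rewrite inE.
Qed.

(** A part of more than k vertices contains the foot of each of its vertices;
    since the parts are disjoint, it then contains every vertex above a foot that
    it contains, and is a union of fibres of [foot]. *)
Lemma dvdn_card_part (P : {set {set G}}) :
  connected_partition P -> (forall B, B \in P -> (k < #|B|)%N) ->
  forall B, B \in P -> (k.+1 %| #|B|)%N.
Proof.
move=> [/and3P[/eqP covP trivP _] Pconn] Pk B BP.
have footB C x : C \in P -> x \in C -> inl (foot x) \in C.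
  move=> CP xC; apply: contraLR (Pk C CP) => fC; rewrite -leqNgt.
  exact: connected_in_arm (Pconn C CP) xC fC.
suff -> : B = [set x : G | foot x \in [set v | inl v \in B]].
  by rewrite card_foot_preim dvdn_mull.
apply/setP => x; rewrite !inE; apply/idP/idP => [|fB]; first exact: footB.
have : x \in cover P by rewrite covP inE.
case/bigcupP => C CP xC; have fC := footB C x CP xC.
by rewrite -(def_pblock trivP BP fB) (def_pblock trivP CP fC).
Qed.

Lemma pendant_no_two_part a b :
  (k < a)%N -> (k < b)%N -> ~~ (k.+1 %| b)%N ->
  ~ has_connected_partition G [:: a; b].
Proof.
move=> ka kb kNb [P [Pc Ptype]].
have memP r : (r \in [:: a; b]) = (r \in [seq #|B : {set G}| | B <- enum P]).
  by rewrite -Ptype mem_sort.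
have Pk B : B \in P -> (k < #|B|)%N.
  move=> BP; have : #|B| \in [:: a; b] by rewrite memP map_f // mem_enum.
  by rewrite !inE => /orP[]/eqP->.
have : b \in [:: a; b] by rewrite !inE eqxx orbT.
rewrite memP => /mapP[B]; rewrite mem_enum => BP bB.
by move: kNb; rewrite bB (dvdn_card_part Pc Pk BP).
Qed.

Lemma card_pendant : #|G| = (#|H| * k.+1)%N.
Proof.
rewrite -[#|H|]cardsT -card_foot_preim -cardsT.
by congr #|pred_of_set _|; apply/setP => x; rewrite !inE.
Qed.

Lemma connected_pendant : connected H -> connected G.
Proof.
move=> [H0 Hconn]; split; first by rewrite card_pendant muln_gt0 H0.
have csym : connect_sym (@adj G) by apply: sym_connect_sym => x y; rewrite adj_sym.
have to_foot x : connect (@adj G) x (inl (foot x)).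
  case: x => [v|[v [j ltj]]] /=; first exact: connect0.
  elim: j ltj => [|j IH] ltj; first by apply: connect1; rewrite /= !eqxx.
  apply: connect_trans (IH (ltnW ltj)); apply: connect1.
  by rewrite /= !eqxx orbT.
move=> x y; apply: connect_trans (to_foot x) _.
rewrite csym; apply: connect_trans (to_foot y) _.
by apply: connect_hom (Hconn (foot y) (foot x)) => u v uv; apply: connect1.
Qed.

(** The parts are n(k+1) - (k+2) and k+2: both exceed k because n >= 3, and k+2
    is not a multiple of k+1 because k >= 1. *)
Lemma pendant_not_e_positive : connected H -> (2 < #|H|)%N -> (0 < k)%N ->
  (exists lam, is_intpart_of (#|H| * (k + 1)) lam /\
     ~ has_connected_partition G lam) /\ ~ e_positive G.
Proof.
move=> Hconn H3 k0.
pose b := k.+2; pose a := (#|H| * k.+1 - b)%N.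
have big : (3 * k.+1 <= #|H| * k.+1)%N by rewrite leq_pmul2r.
have ab : (a + b)%N = (#|H| * k.+1)%N by rewrite subnK //; apply: leq_trans big; lia.
have ba : (b <= a)%N by rewrite /a leq_subRL; rewrite /b; lia.
have nocp : ~ has_connected_partition G [:: a; b].
  apply: pendant_no_two_part => //; first exact: leq_trans ba.
  by rewrite /b -[k.+2]addn1 dvdn_addr // dvdn1 eqSS -lt0n.
split.
  exists [:: a; b]; split=> //; rewrite /is_intpart_of /is_intpart /=.
  by rewrite !inE ba (ltn_eqF (leq_trans _ ba)) //= addn0 addn1 ab eqxx.
by apply: not_e_positive_of_two_part (connected_pendant Hconn) _ _ nocp;
  rewrite ?ba ?card_pendant.
Qed.

End Pendant.

(** * Suns and complete suns *)

Lemma connected_cycle n : (0 < n)%N -> connected (cycle_graph n).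
Proof.
case: n => // n _; split=> [|x y]; first by rewrite card_ord.
have csym : connect_sym (@adj (cycle_graph n.+1)).
  by apply: sym_connect_sym => u v; rewrite adj_sym.
suff to0 (v : 'I_n.+1) : connect (@adj (cycle_graph n.+1)) ord0 v.
  by apply: (connect_trans (y := ord0)) => //; rewrite csym.
case: v => j; elim: j => [|j IH] ltj.
  by rewrite (_ : Ordinal ltj = ord0) ?connect0 //; apply: val_inj.
apply: connect_trans (IH (ltnW ltj)) _; apply: connect1.
by rewrite /= /cycle_adj -val_eqE /= eqxx andbT ltn_eqF.
Qed.

Lemma connected_complete n : (0 < n)%N -> connected (complete_graph n).
Proof.
move=> n0; split=> [|x y]; first by rewrite card_ord.
by have [->|xy] := eqVneq x y; [exact: connect0|exact: connect1].
Qed.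

Local Close Scope ring_scope.

Theorem theorem3p3 (n k : nat) (hn : 3 <= n) (hk : 1 <= k) :
  ((exists lam : seq nat, is_intpart_of (n * (k + 1)) lam /\
      ~ has_connected_partition (sun (fun _ : 'I_n => k)) lam) /\
   ~ e_positive (sun (fun _ : 'I_n => k))) /\
  ((exists lam : seq nat, is_intpart_of (n * (k + 1)) lam /\
      ~ has_connected_partition (complete_sun (fun _ : 'I_n => k)) lam) /\
   ~ e_positive (complete_sun (fun _ : 'I_n => k))).
Proof.
have n0 : 0 < n by apply: leq_trans hn.
split; rewrite -[n in n * _]card_ord.
- by apply: pendant_not_e_positive (connected_cycle n0) _ hk; rewrite card_ord.
- by apply: pendant_not_e_positive (connected_complete n0) _ hk; rewrite card_ord.
Qed.
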